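(* Let $\mathrm{StNaamen}$ be the labelled category and $\mathrm{QtNaamen}$ its full subcategory of uniform objects, with the induced labelling, as defined in the context. Then $\mathrm{QtNaamen}$ is a closed model category. That is: (1) the category $\mathrm{QtNaamen}$ with the induced classes (c) of co-fibrations, (f) of fibrations and (w) of weak equivalences satisfies axioms (M0), (M1), (M2), (M3), (M4), (M5) and (M6) listed in the context; (2) every object $\mathcal{C}$ of $\mathrm{StNaamen}$ such that the arrow $\emptyset \to \mathcal{C}$ is labelled (c) in $\mathrm{StNaamen}$ (i.e. every co-fibrant object of $\mathrm{StNaamen}$) is an object of $\mathrm{QtNaamen}$.
   Context: Conventions. For definiteness fix a strongly inaccessible cardinal $\kappa$; ''set'' means an element of $V_\kappa$ and ''class'' means a subset of $V_\kappa$ (any other standard treatment of classes would do). Countable means of cardinality at most $\aleph_0$. The category $\mathrm{StNaamen}$. Its objects are the nonempty classes of sets (the empty class is identified with $\{\emptyset\}$). There is a unique arrow $\mathcal{X}\to\mathcal{Y}$ if for every $X\in\mathcal{X}$ there is $Y\in\mathcal{Y}$ with $X\subseteq Y$, and no arrow $\mathcal X\to\mathcal Y$ otherwise. So it is a preorder regarded as a category, and all diagrams commute. The initial object $\{\emptyset\}$ is denoted $\emptyset$. For sets $A,B$ there is an arrow $\{A\}\to\{B\}$ iff $A\subseteq B$. Lifting. For arrows $\mathcal{X}\to\mathcal{Y}$ and $\mathcal{A}\to\mathcal{B}$, write $(\mathcal{X}\to\mathcal{Y})\pitchfork(\mathcal{A}\to\mathcal{B})$ if whenever there are arrows $\mathcal{X}\to\mathcal{A}$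 and $\mathcal{Y}\to\mathcal{B}$ there is an arrow $\mathcal{Y}\to\mathcal{A}$. One says that the first arrow has the left lifting property with respect to the second, and the second has the right lifting property with respect to the first. Labelling of $\mathrm{StNaamen}$. (wc)$_0$: arrows $\{A\}\to\{B\}$ with $A \subseteq B$ sets and $B\setminus A$ finite. (c)$_0$: arrows $\{A\}\to\{B\}$ with $A\subseteq B$ sets and $\operatorname{card}B\le\operatorname{card}A+\aleph_0$ (equivalently $\operatorname{card}A+\aleph_0=\operatorname{card}B+\aleph_0$). (f): arrows with the right lifting property with respect to all (wc)$_0$ arrows. (wf): arrows with the right lifting property with respect to all (c)$_0$ arrows. (wc): arrows with the left lifting property with respect to all (f) arrows. (c): arrows with the left lifting property with respect to all (wf) arrows. (w): arrows $\mathcal{X}\to\mathcal{Y}$ for which there is an object $\mathcal{Z}$ such that $\mathcal{X}\to\mathcal{Z}$ is a (wc) arrow and $\mathcal{Z}\to\mathcal{Y}$ is a (wf) arrow. The category $\mathrm{QtNaamen}$. An object $\mathcal{X}$ of $\mathrm{StNaamen}$ uniformly covers a set $X$ if every countable subset of $X$ is contained in a member of $\mathcal{X}$ and, for all $X'\subseteq X$, if $X'\subseteq C$ for some $C\in\mathcal{X}$ then every $X''\subseteq X$ with $\operatorname{card}X''\le\operatorname{card}X'$ is contained in some member of $\mathcal{X}$. The object $\mathcal{X}$ is uniform if it uniformly covers every set $X$ all of whose countable subsets are contained in members of $\mathcal{X}$. $\mathrm{QtNaamen}$ is the full subcategory of $\mathrm{StNaamen}$ on the uniform objects; an arrow of it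 carries a label iff it carries that label in $\mathrm{StNaamen}$. Axioms for a category with classes of arrows (c), (f), (w); an arrow is called a trivial co-fibration if it is labelled both (w) and (c), and a trivial fibration if it is labelled both (w) and (f). (M0) All finite limits and finite colimits exist. (M1) Every trivial co-fibration has the left lifting property with respect to every fibration, and every co-fibration has the left lifting property with respect to every trivial fibration. (M2) Every arrow factors as a co-fibration followed by a trivial fibration, and also as a trivial co-fibration followed by a fibration. (M3) Fibrations and co-fibrations are each closed under composition; every isomorphism is labelled (w), (c) and (f); fibrations are stable under base change (pullback) and co-fibrations are stable under co-base change (pushout). (M4) The base change of a trivial fibration is labelled (w), and the co-base change of a trivial co-fibration is labelled (w). (M5) If in a triangle $\mathcal{X}\to\mathcal{Y}\to\mathcal{Z}$, $\mathcal{X}\to\mathcal{Z}$ two of the three arrows are labelled (w), so is the third. (M6) (closedness) An arrow is labelled (f) iff it has the right lifting property with respect to all trivial co-fibrations; it is labelled (c) iff it has the left lifting property with respect to all trivial fibrations; it is labelled (w) iff it is a composition $u\circ v$ where $v$ has the left lifting property with respect to all (f) arrows and $u$ has the right lifting property with respect to all (c) arrows. (All arrows are taken in the category in question.) *)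

(* Defs.v *)
From mathcomp Require Import all_boot.
From mathcomp Require Import boolp classical_sets functions cardinality.

Set Implicit Arguments.
Unset Strict Implicit.
Unset Printing Implicit Defensive.

Local Open Scope classical_set_scope.
Local Open Scope card_scope.

(* [comp g f] is the composite "g after f". *)
Record category := Category {
  ob :> Type;
  hom : ob -> ob -> Type;
  idc : forall X, hom X X;
  comp : forall X Y Z, hom Y Z -> hom X Y -> hom X Z;
  comp_idl : forall X Y (f : hom X Y), comp (idc Y) f = f;
  comp_idr : forall X Y (f : hom X Y), comp f (idc X) = f;
  compA : forall X Y Z W (h : hom Z W) (g : hom Y Z) (f : hom X Y),
    comp h (comp g f) = comp (comp h g) f }.

Arguments hom {c} _ _.
Arguments idc {c} _.
Arguments comp {c X Y Z} _ _.

Declare Scope cat_scope.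
Delimit Scope cat_scope with cat.
Notation "g \o f" := (comp g f) : cat_scope.

Definition is_iso (C : category) (X Y : C) (f : hom X Y) : Prop :=
  exists g : hom Y X, (g \o f)%cat = idc X /\ (f \o g)%cat = idc Y.

Record functor (J C : category) := Functor {
  fob :> J -> C;
  fhom : forall i j, hom i j -> hom (fob i) (fob j);
  fhom_id : forall i, fhom (idc i) = idc (fob i);
  fhom_comp : forall i j k (b : hom j k) (a : hom i j),
    fhom (b \o a)%cat = (fhom b \o fhom a)%cat }.

Arguments fhom {J C} _ {i j} _.

Section Limits.
Variables (J C : category) (D : functor J C).

Definition is_cone (L : C) (p : forall j, hom L (D j)) : Prop :=
  forall i j (a : hom i j), (fhom D a \o p i)%cat = p j.

Definition is_limit (L : C) (p : forall j, hom L (D j)) : Prop :=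
  is_cone p /\
  forall (M : C) (q : forall j, hom M (D j)), is_cone q ->
    exists! h : hom M L, forall j, (p j \o h)%cat = q j.

Definition is_cocone (L : C) (p : forall j, hom (D j) L) : Prop :=
  forall i j (a : hom i j), (p j \o fhom D a)%cat = p i.

Definition is_colimit (L : C) (p : forall j, hom (D j) L) : Prop :=
  is_cocone p /\
  forall (M : C) (q : forall j, hom (D j) M), is_cocone q ->
    exists! h : hom L M, forall j, (h \o p j)%cat = q j.

End Limits.

Definition finite_category (J : category) : Prop :=
  finite_set [set: J] /\ forall i j : J, finite_set [set: hom i j].

Definition has_finite_limits (C : category) : Prop :=
  forall (J : category) (D : functor J C), finite_category J ->
    exists (L : C) (p : forall j, hom L (D j)), is_limit p.

Definition has_finite_colimits (C : category) : Prop :=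
  forall (J : category) (D : functor J C), finite_category J ->
    exists (L : C) (p : forall j, hom (D j) L), is_colimit p.

(*      g'
   X' ----> X
   |        |
   | f'     | f
   v        v
   Y' ----> Y
       g        *)
Definition is_pullback (C : category) (X' X Y' Y : C)
    (f' : hom X' Y') (g' : hom X' X) (f : hom X Y) (g : hom Y' Y) : Prop :=
  (f \o g' = g \o f')%cat /\
  forall (T : C) (a : hom T X) (b : hom T Y'), (f \o a = g \o b)%cat ->
    exists! h : hom T X', (g' \o h = a)%cat /\ (f' \o h = b)%cat.

(*      g
   X ----> X'
   |       |
   | f     | f'
   v       v
   Y ----> Y'
       g'       *)
Definition is_pushout (C : category) (X X' Y Y' : C)
    (f : hom X Y) (g : hom X X') (f' : hom X' Y') (g' : hom Y Y') : Prop :=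
  (g' \o f = f' \o g)%cat /\
  forall (T : C) (a : hom Y T) (b : hom X' T), (a \o f = b \o g)%cat ->
    exists! h : hom Y' T, (h \o g' = a)%cat /\ (h \o f' = b)%cat.

Definition lifts (C : category) (X Y A B : C)
    (i : hom X Y) (p : hom A B) : Prop :=
  forall (u : hom X A) (v : hom Y B), (p \o u = v \o i)%cat ->
    exists d : hom Y A, (d \o i = u)%cat /\ (p \o d = v)%cat.

Definition arrow_class (C : category) := forall X Y : C, hom X Y -> Prop.

Definition llp (C : category) (K : arrow_class C) : arrow_class C :=
  fun X Y i => forall (A B : C) (p : hom A B), K A B p -> lifts i p.

Definition rlp (C : category) (K : arrow_class C) : arrow_class C :=
  fun A B p => forall (X Y : C) (i : hom X Y), K X Y i -> lifts i p.

Record labelled_category := LabelledCategory {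
  underlying :> category;
  cof : arrow_class underlying;
  fib : arrow_class underlying;
  weq : arrow_class underlying }.

Arguments cof {_ X Y} _.
Arguments fib {_ X Y} _.
Arguments weq {_ X Y} _.

Section ModelCategory.
Variable C : labelled_category.

Definition triv_cof : arrow_class C := fun X Y f => weq f /\ cof f.
Definition triv_fib : arrow_class C := fun X Y f => weq f /\ fib f.

Definition axiom_M0 : Prop := has_finite_limits C /\ has_finite_colimits C.

Definition axiom_M1 : Prop :=
  forall (X Y A B : C) (i : hom X Y) (p : hom A B),
    (triv_cof i -> fib p -> lifts i p) /\
    (cof i -> triv_fib p -> lifts i p).

Definition axiom_M2 : Prop :=
  forall (X Y : C) (f : hom X Y),
    (exists (Z : C) (i : hom X Z) (p : hom Z Y),
       [/\ f = (p \o i)%cat, cof i & triv_fib p]) /\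
    (exists (Z : C) (i : hom X Z) (p : hom Z Y),
       [/\ f = (p \o i)%cat, triv_cof i & fib p]).

Definition axiom_M3 : Prop :=
  [/\ forall (X Y Z : C) (f : hom X Y) (g : hom Y Z),
        fib f -> fib g -> fib (g \o f)%cat,
      forall (X Y Z : C) (f : hom X Y) (g : hom Y Z),
        cof f -> cof g -> cof (g \o f)%cat,
      forall (X Y : C) (f : hom X Y),
        is_iso f -> [/\ weq f, cof f & fib f],
      forall (X' X Y' Y : C)
          (f' : hom X' Y') (g' : hom X' X) (f : hom X Y) (g : hom Y' Y),
        is_pullback f' g' f g -> fib f -> fib f'
    & forall (X X' Y Y' : C)
          (f : hom X Y) (g : hom X X') (f' : hom X' Y') (g' : hom Y Y'),
        is_pushout f g f' g' -> cof f -> cof f'].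

Definition axiom_M4 : Prop :=
  (forall (X' X Y' Y : C)
      (f' : hom X' Y') (g' : hom X' X) (f : hom X Y) (g : hom Y' Y),
    is_pullback f' g' f g -> triv_fib f -> weq f') /\
  (forall (X X' Y Y' : C)
      (f : hom X Y) (g : hom X X') (f' : hom X' Y') (g' : hom Y Y'),
    is_pushout f g f' g' -> triv_cof f -> weq f').

Definition axiom_M5 : Prop :=
  forall (X Y Z : C) (f : hom X Y) (g : hom Y Z),
    [/\ weq f -> weq g -> weq (g \o f)%cat,
        weq f -> weq (g \o f)%cat -> weq g
      & weq g -> weq (g \o f)%cat -> weq f].

Definition axiom_M6 : Prop :=
  forall (X Y : C) (f : hom X Y),
    [/\ fib f <-> rlp triv_cof f,
        cof f <-> llp triv_fib f
      & weq f <-> exists (Z : C) (v : hom X Z) (u : hom Z Y),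
          [/\ f = (u \o v)%cat, llp (@fib C) v & rlp (@cof C) u]].

Definition closed_model_category : Prop :=
  [/\ axiom_M0, axiom_M1, axiom_M2 & axiom_M3] /\
  [/\ axiom_M4, axiom_M5 & axiom_M6].

End ModelCategory.

Section FullSubcategory.
Variables (C : labelled_category) (P : C -> Prop).

Definition full_subcategory : category :=
  @Category {X : C | P X} (fun X Y => hom (sval X) (sval Y))
    (fun X => idc (sval X)) (fun X Y Z g f => (g \o f)%cat)
    (fun X Y f => comp_idl f) (fun X Y f => comp_idr f)
    (fun X Y Z W h g f => compA h g f).

Definition full_labelled_subcategory : labelled_category :=
  @LabelledCategory full_subcategory
    (fun X Y f => @cof C (sval X) (sval Y) f)
    (fun X Y f => @fib C (sval X) (sval Y) f)
    (fun X Y f => @weq C (sval X) (sval Y) f).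

End FullSubcategory.

(* A model of second-order ZF; [elts A x] reads "x is an element of A".  Since
   [set V] contains every subset of V, replacement is the full second-order
   axiom, so by Zermelo's theorem these structures are, up to isomorphism,
   exactly the (V_kappa, \in) with kappa strongly inaccessible.  Sets are the
   points of V, classes are the subsets [set V].  Separation, the empty set and
   pairing follow from the listed axioms, and choice from the ambient one. *)
Record set_universe := SetUniverse {
  V :> Type;
  elts : V -> set V;
  extensionality : injective elts;
  foundation : well_founded (fun x A => elts A x);
  union_ax : forall A, exists B,
    elts B = [set x | exists2 Y, elts A Y & elts Y x];
  powerset_ax : forall A, exists B, elts B = [set X | elts X `<=` elts A];
  replacement_ax : forall (A : V) (F : V -> V -> Prop),
    (forall x y z, F x y -> F x z -> y = z) ->
    exists B, elts B = [set y | exists2 x, elts A x & F x y];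
  infinity_ax : exists A,
    (exists2 e, elts A e & elts e = set0) /\
    (forall n, elts A n -> exists2 s, elts A s & elts s = elts n `|` [set n]) }.

Arguments elts {s} _.

Section Naamen.
Variable U : set_universe.
Implicit Types A B S : U.

Definition st_ob := {X : set U | X !=set0}.

Definition st_hom (X Y : st_ob) : Prop :=
  forall A, sval X A -> exists2 B, sval Y B & elts A `<=` elts B.

Lemma st_id (X : st_ob) : st_hom X X.
Proof. by move=> A XA; exists A. Qed.

Lemma st_comp (X Y Z : st_ob) : st_hom Y Z -> st_hom X Y -> st_hom X Z.
Proof.
move=> g f A /f[B /g[D ZD BD] AB]; exists D => //.
exact: subset_trans AB BD.
Qed.

Definition StNaamen_cat : category :=
  @Category st_ob (fun X Y => st_hom X Y) st_id st_comp
    (fun X Y f => Prop_irrelevance _ _) (fun X Y f => Prop_irrelevance _ _)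
    (fun X Y Z W h g f => Prop_irrelevance _ _).

(* card B <= card A + aleph_0, the sum being realized by a disjoint union. *)
Definition card_le_add_aleph0 (B A : U) : Prop :=
  elts B #<= (inl @` elts A `|` range inr : set (U + nat)).

Definition wc0 : arrow_class StNaamen_cat := fun X Y _ =>
  exists A B, [/\ sval X = [set A], sval Y = [set B],
    elts A `<=` elts B & finite_set (elts B `\` elts A)].

Definition c0 : arrow_class StNaamen_cat := fun X Y _ =>
  exists A B, [/\ sval X = [set A], sval Y = [set B],
    elts A `<=` elts B & card_le_add_aleph0 B A].

Definition st_f : arrow_class StNaamen_cat := rlp wc0.
Definition st_wf : arrow_class StNaamen_cat := rlp c0.
Definition st_wc : arrow_class StNaamen_cat := llp st_f.
Definition st_c : arrow_class StNaamen_cat := llp st_wf.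
Definition st_w : arrow_class StNaamen_cat := fun X Y _ =>
  exists (Z : StNaamen_cat) (i : hom X Z) (p : hom Z Y), st_wc i /\ st_wf p.

Definition StNaamen : labelled_category :=
  LabelledCategory st_c st_f st_w.

Lemma st_empty_subproof : [set e : U | elts e = set0] !=set0.
Proof. by have [A [[e _ e0] _]] := infinity_ax U; exists e. Qed.

(* The class whose only member is the empty set. *)
Definition st_empty : StNaamen := exist _ _ st_empty_subproof.

Definition covered (X : StNaamen) (S : U) : Prop :=
  exists2 A, sval X A & elts S `<=` elts A.

Definition countably_covers (X : StNaamen) (S : U) : Prop :=
  forall D : U, elts D `<=` elts S -> countable (elts D) -> covered X D.

Definition uniformly_covers (X : StNaamen) (S : U) : Prop :=
  countably_covers X S /\
  forall S' : U, elts S' `<=` elts S -> covered X S' ->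
    forall S'' : U, elts S'' `<=` elts S -> elts S'' #<= elts S' ->
      covered X S''.

Definition uniform (X : StNaamen) : Prop :=
  forall S : U, countably_covers X S -> uniformly_covers X S.

Definition QtNaamen : labelled_category := full_labelled_subcategory uniform.

End Naamen.

Arguments st_empty {U}.

(* Main.v *)
From mathcomp Require Import all_boot.
From mathcomp Require Import boolp classical_sets functions cardinality.
Require Import Defs.

(** StNaamen is a preorder: an arrow X -> Y exists iff every set covered by X
(contained in a member of X) is covered by Y.  All arrows being unique, a
lifting problem is a question about the mere existence of an arrow, and an
object matters only through the downward closed class of sets it covers.

Both generating classes have the same shape: arrows {S} -> {T} with S a subset
of T and R S T, where R says either that T \ S is finite or that
card T <= card S + aleph_0.  An arrow X -> Y has the right lifting property
against them iff X is closed, among the sets covered by Y, under such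
extensions (rlp_generatedP).  Closing X in this way inside Y gives an object
hull R X Y, and X -> hull R X Y -> Y is a factorization of X -> Y into an arrow
of the left class and one of the right class.  This produces both weak
factorization systems of StNaamen; as (wc) = (w) and (c), and (wf) = (w) and
(f), the lifting, factorization and closedness axioms follow in every full
subcategory that is closed under the two hulls.

That uniform objects are closed under hulls is where uniformity is used.
- For card T <= card S + aleph_0: if Y is uniform, S' is infinite and covered
  by the hull, and card S'' <= card S', then S' and S' u S'' have the same
  cardinality; so Y covers S' u S'' and the extension property puts it in the
  hull (uniform_ext_closed_card).  This needs k + k = k for infinite cardinals,
  proved by splitting all but finitely many points of a set into disjoint
  sequences (exists_cofinite_doubling).
- For T \ S finite: the hull covers T iff Y covers T and X covers a cofinite
  part of T (covered_hull_finite).  A diagonal argument makes this cofinite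
  part uniform: if X covers every countable subset of S up to finitely many
  points, then S has one cofinite part all of whose countable subsets are
  covered by X (cofinite_countably_covers).  Uniformity of X applies to it.

Intersections of uniform objects are uniform, hence limits are intersections,
and colimits are intersections of all uniform upper bounds.  Base change can be
tested on the objects {T}, which are uniform; co-base change follows from the
uniformity of hulls.

For two-out-of-three, X -> Y is a weak equivalence iff whenever X covers S, Y
covers T, S is a subset of T and card T <= card S + aleph_0, then X covers a
cofinite part of T (st_wP).  This criterion gives two of the three cases by
removing finitely many points.  The third one, from X -> Z to Y -> Z, again
combines the diagonal argument with uniformity (st_w_cancel_left).

Finally a co-fibrant object covers only countable sets, since the class of
countable covered sets is already closed under the extensions of (c)_0; and an
object that covers only countable sets is uniform for trivial reasons. *)

Set Implicit Arguments.
Unset Strict Implicit.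
Unset Printing Implicit Defensive.

Local Open Scope classical_set_scope.
Local Open Scope card_scope.

(** * Cardinal arithmetic *)

Lemma card_le_of_inj (T U : Type) (A : set T) (B : set U) (f : T -> U) :
  set_fun A B f -> set_inj A f -> A #<= B.
Proof.
move=> fAB finj; have [g] : $|{injfun A >-> B}| by apply/injfunPex; exists f.
exact: inj_card_le g.
Qed.

Lemma card_le_inj (T U : Type) (A : set T) (B : set U) :
  B !=set0 -> A #<= B -> exists2 f : T -> U, set_fun A B f & set_inj A f.
Proof.
move=> [b Bb] /card_leP[g].
pose f x := if pselect (A x) is left Ax then set_val (g (SigSub (mem_set Ax))) else b.
exists f => [x Ax|x y /set_mem Ax /set_mem Ay]; rewrite /f.
  by case: pselect => // Ax'; apply: set_valP.
case: pselect => // Ax'; case: pselect => // Ay' /val_inj /inj.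
by move=> /(_ (mem_set I) (mem_set I)) [].
Qed.

(** C x {0, 1} injects into C; the injection is kept as a function of two
arguments so that injections of disjoint sets can be glued. *)
Definition doubling (T : Type) (C : set T) : Prop :=
  exists f : T -> bool -> T, (forall x b, C x -> C (f x b)) /\
    (forall x y b c, C x -> C y -> f x b = f y c -> x = y /\ b = c).

Lemma infinite_range_inj (T : Type) (s : nat -> T) (A : set T) :
  injective s -> range s `<=` A -> infinite_set A.
Proof.
move=> sinj sA; apply/infiniteP.
by apply: (@card_le_of_inj _ _ _ _ s) => [n _|m n _ _ /sinj]//; apply: sA; exists n.
Qed.

(** This is k + k = k up to a finite set.  Take a maximal family of disjoint
injective sequences in A.  Their ranges leave out finitely many points, for
otherwise one more sequence would fit; and each sequence s doubles itself by
sending s n to s (2 n) and s (2 n + 1). *)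
Lemma exists_cofinite_doubling (T : Type) (A : set T) : infinite_set A ->
  exists C, [/\ C `<=` A, infinite_set C, finite_set (A `\` C) & doubling C].
Proof.
move=> Ainf.
have [E [ED Etriv Emax]] := ex_maximal_disjoint_subcollection
  (fun s : nat -> T => range s) [set s | injective s /\ range s `<=` A].
pose C := \bigcup_(s in E) range s.
have CA : C `<=` A by move=> x [s /ED[_ sA] sx]; exact: sA.
have fin : finite_set (A `\` C).
  apply: contrapT => /[dup] /infinite_setN0 ne /infiniteP /(card_le_inj ne)[s sAC sinj].
  have sinj' : injective s by move=> m n; apply: sinj; apply/mem_set.
  have NEs : ~ E s.
    by move=> Es; have [_] := sAC 0 I; apply; exists s => //; exists 0.
  apply: (Emax (E `|` [set s])).
  - by split=> [t|/(_ s (or_intror erefl))] //; left.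
  - move=> t [/ED//|->]; split=> // _ [n _ <-]; exact: (sAC n I).1.
  - have disj t : E t -> ~ ((range t `&` range s) !=set0).
      by move=> Et [x [tx [n _ snx]]]; have [_] := sAC n I; apply; exists t => //; rewrite snx.
    move=> t u [Et|->] [Eu|->] //; [exact: Etriv|by move/(disj t Et)|].
    by rewrite setIC => /(disj u Eu).
(* p x locates x: the sequence through x, and the position of x in it. *)
have /choice[p pP] : forall x, exists q : (nat -> T) * nat, C x -> E q.1 /\ q.1 q.2 = x.
  move=> x; have [[s Es [n _ snx]]|NCx] := pselect (C x); last by exists (fun=> x, 0).
  by exists (s, n).
exists C; split=> //.
  have [s Es] : E !=set0.
    apply: contrapT => E0; apply: Ainf; apply: sub_finite_set fin => x Ax.
    by split=> // -[s Es]; case: E0; exists s.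
  apply: (@infinite_range_inj _ s); first by have [] := ED s Es.
  by move=> x sx; exists s.
exists (fun x b => (p x).1 (b + (p x).2.*2)); split=> [x b /pP[Ep _]|x y b c /pP[Ex px] /pP[Ey py] e].
  by exists (p x).1 => //; eexists.
have ep : (p x).1 = (p y).1.
  apply: Etriv => //; exists ((p y).1 (c + (p y).2.*2)); split; last by eexists.
  by rewrite -e; eexists.
move: e; rewrite ep => /(ED _ Ey).1 e; split.
  by rewrite -px -py ep -(half_bit_double (p x).2 b) e half_bit_double.
by move/(congr1 odd): e; rewrite !oddD !odd_double !addbF; case: (b); case: (c).
Qed.

Lemma card_le_setU_doubling (T W : Type) (A B : set T) (C : set W) :
  C !=set0 -> doubling C -> A #<= C -> B #<= C -> A `|` B #<= C.
Proof.
move=> C0 [f [fC finj]] /(card_le_inj C0)[g gC ginj] /(card_le_inj C0)[h hC hinj].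
apply: (@card_le_of_inj _ _ _ _
  (fun x => if pselect (A x) then f (g x) true else f (h x) false)).
  move=> x ABx /=; case: pselect => /= [Ax|NAx]; apply: fC; first exact: gC.
  by case: ABx => // /hC.
move=> x y /set_mem ABx /set_mem ABy.
case: pselect => /= [Ax|NAx]; case: pselect => /= [Ay|NAy].
- by move=> /(finj _ _ _ _ (gC _ Ax) (gC _ Ay))[+ _]; apply: ginj; apply/mem_set.
- by case: ABy => // By /(finj _ _ _ _ (gC _ Ax) (hC _ By))[].
- by case: ABx => // Bx /(finj _ _ _ _ (hC _ Bx) (gC _ Ay))[].
- case: ABx ABy => // Bx [] // By /(finj _ _ _ _ (hC _ Bx) (hC _ By))[+ _].
  by apply: hinj; apply/mem_set.
Qed.

Lemma countable_card_le (T W : Type) (A : set T) (B : set W) :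
  countable A -> infinite_set B -> A #<= B.
Proof. by move=> Ac /infiniteP; exact: card_le_trans. Qed.

(** The finite remainder left by the doubling subset C of D is absorbed first:
it injects into C, as does C itself, so D has the cardinality of C. *)
Lemma card_le_setU (T W : Type) (A B : set T) (D : set W) :
  infinite_set D -> A #<= D -> B #<= D -> A `|` B #<= D.
Proof.
move=> /exists_cofinite_doubling[C [CD Cinf DCfin Cdbl]] AD BD.
have C0 := infinite_setN0 Cinf.
have DC : D #<= C.
  rewrite -(setDUK CD); apply: card_le_setU_doubling => //.
  by apply: countable_card_le => //; exact: finite_set_countable.
apply: (card_le_trans (card_le_setU_doubling C0 Cdbl _ _) (subset_card_le CD)).
- exact: card_le_trans DC.
- exact: card_le_trans DC.
Qed.

Lemma card_le_cofinite (T : Type) (A B : set T) :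
  infinite_set A -> finite_set (A `\` B) -> A #<= A `&` B.
Proof.
move=> Ainf fin; have inf : infinite_set (A `&` B).
  by move=> finI; apply: Ainf; rewrite -(setUIDK A B) finite_setU.
rewrite -[X in X #<= _](setUIDK A B); apply: card_le_setU => //.
by apply: countable_card_le => //; exact: finite_set_countable.
Qed.

(** The sum with aleph_0 only matters when A is finite, where it lets B be
countable. *)
Lemma card_le_add_aleph0P (U : set_universe) (B A : U) :
  card_le_add_aleph0 B A <-> countable (elts B) \/ elts B #<= elts A.
Proof.
have inl_inj W W' (X : set W) : set_inj X (@inl W W') by move=> x y _ _ [].
split=> [BA|[Bc|BA]].
- have [Afin|Ainf] := pselect (finite_set (elts A)); [left|right].
    apply: card_le_trans BA _; apply: card_le_setU.
    + exact: infinite_nat.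
    + by apply: card_le_trans (card_image_le _ _) _; exact: finite_set_countable.
    + exact: card_image_le.
  apply: card_le_trans BA _; apply: card_le_setU => //; first exact: card_image_le.
  by apply: countable_card_le => //; exact: card_image_le.
- apply: card_le_trans Bc _.
  by apply: (@card_le_of_inj _ _ _ _ inr) => [n _|m n _ _ []] //; right; exists n.
- apply: card_le_trans BA _; apply: (@card_le_of_inj _ _ _ _ inl) => // x Ax.
  by left; exists x.
Qed.

(** * Lifting in a preorder *)

Section ThinLifts.
Variables (C : category) (thin : forall (X Y : C) (f g : hom X Y), f = g).

Lemma thin_lifts (X Y A B : C) (i : hom X Y) (p : hom A B) :
  (hom X A -> hom Y B -> inhabited (hom Y A)) -> lifts i p.
Proof. by move=> H u v _; have [d] := H u v; exists d. Qed.

Lemma lifts_diagonal (X Y A B : C) (i : hom X Y) (p : hom A B) :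
  lifts i p -> hom X A -> hom Y B -> inhabited (hom Y A).
Proof. by move=> ip u v; have [|d _] := ip u v; [exact: thin|exists]. Qed.

End ThinLifts.

(** * Covered sets *)

Section Universe.
Variable U : set_universe.
Implicit Types (S T : U) (X Y Z : StNaamen U).

Lemma separation S (P : set U) : exists T, elts T = elts S `&` P.
Proof.
have [x y z [<- _] [<- _] //|T ET] := @replacement_ax U S (fun x y => x = y /\ P x).
exists T; rewrite ET; apply/seteqP; split=> [y [x Sx [<- Px]]|x [Sx Px]] //.
by exists x.
Qed.

Lemma covered_sub X S T : elts S `<=` elts T -> covered X T -> covered X S.
Proof. by move=> ST [A XA TA]; exists A => //; exact: subset_trans TA. Qed.

Lemma hom_coveredP X Y :
  st_hom X Y <-> forall S, covered X S -> covered Y S.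
Proof.
split=> [XY S [A /XY[B YB AB] SA]|XY A XA].
  by exists B => //; exact: subset_trans AB.
by have [|B YB AB] := XY A; [exists A|exists B].
Qed.

Lemma covered_hom X Y S : st_hom X Y -> covered X S -> covered Y S.
Proof. by move=> /hom_coveredP; apply. Qed.

Lemma covered_empty X S : elts S = set0 -> covered X S.
Proof. by move=> S0; have [A XA] := svalP X; exists A; rewrite ?S0. Qed.

Definition downward_closed (P : set U) : Prop :=
  forall S T, elts S `<=` elts T -> P T -> P S.

Lemma covered_downward_closed (P : set U) (P0 : P !=set0) S :
  downward_closed P -> covered (exist _ P P0 : StNaamen U) S <-> P S.
Proof. by move=> dP; split=> [[A PA /dP]|PS]; [apply|exists S]. Qed.

Definition singleton S : StNaamen U := exist _ [set S] (ex_intro _ S erefl).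

Lemma covered_singleton S T : covered (singleton S) T <-> elts T `<=` elts S.
Proof. by split=> [[_ ->]|TS] //; exists S. Qed.

Lemma singleton_hom S X : covered X S -> st_hom (singleton S) X.
Proof. by move=> [A XA SA] _ ->; exists A. Qed.

(** If {S} covers all countable subsets of T, it covers the points of T, so T is a
subset of S. *)
Lemma uniform_singleton S : uniform (singleton S).
Proof.
move=> T /= ST; split=> // T' _ _ T'' T''T _; apply/covered_singleton => x T''x.
have [D eD] := separation T [set x].
have : covered (singleton S) D.
  apply: ST; rewrite eD; first by move=> y [].
  by apply: sub_countable (countable1 x); apply: subset_card_le => y [].
by move/covered_singleton; apply; rewrite eD; split=> //; exact: T''T.
Qed.

Section Generated.
Variable R : U -> U -> Prop.

Definition generated : arrow_class (StNaamen_cat U) := fun X Y _ =>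
  exists A B, [/\ sval X = [set A], sval Y = [set B], elts A `<=` elts B & R A B].

Definition ext_closed X Y : Prop := forall S T,
  covered X S -> covered Y T -> elts S `<=` elts T -> R S T -> covered X T.

Lemma st_thin (X Y : StNaamen_cat U) (f g : hom X Y) : f = g.
Proof. exact: (@Prop_irrelevance (st_hom X Y)). Qed.

Lemma rlp_generatedP X Y (p : hom X Y) : rlp generated p <-> ext_closed X Y.
Proof.
split=> [H S T XS YT ST RST|H A B i [S [T [eA eB ST RST]]]].
  have i : st_hom (singleton S) (singleton T) by apply/singleton_hom/covered_singleton.
  have gi : @generated (singleton S) (singleton T) i by exists S, T.
  have [] := lifts_diagonal st_thin (H _ _ i gi) (singleton_hom XS) (singleton_hom YT).
  by move=> /covered_hom; apply; apply/covered_singleton.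
apply: thin_lifts; first exact: st_thin.
move=> AX BY; constructor => T'; rewrite eB => ->.
apply: (H S T) => //.
  by apply: covered_hom AX _; exists S; rewrite ?eA.
by apply: covered_hom BY _; exists T; rewrite ?eB.
Qed.

(** One round of extensions followed by taking subsets need not be closed under
extensions again, so the closure is generated inductively. *)
Inductive hull_mem X Y : set U :=
| hull_base S : covered X S -> hull_mem X Y S
| hull_sub S T : elts S `<=` elts T -> hull_mem X Y T -> hull_mem X Y S
| hull_ext S T : hull_mem X Y S -> covered Y T -> elts S `<=` elts T -> R S T ->
    hull_mem X Y T.

Lemma hull_nonempty X Y : hull_mem X Y !=set0.
Proof. by have [A XA] := svalP X; exists A; apply: hull_base; exists A. Qed.

Definition hull X Y : StNaamen U := exist _ (hull_mem X Y) (hull_nonempty X Y).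

Lemma covered_hull X Y S : covered (hull X Y) S <-> hull_mem X Y S.
Proof. by apply: covered_downward_closed => A B; exact: hull_sub. Qed.

Lemma hom_hull X Y : st_hom X (hull X Y).
Proof. by apply/hom_coveredP => S XS; apply/covered_hull/hull_base. Qed.

Lemma hull_hom X Y : st_hom X Y -> st_hom (hull X Y) Y.
Proof.
move=> XY; apply/hom_coveredP => S /covered_hull; elim=> // {}S.
  exact: covered_hom.
by move=> T ST _; exact: covered_sub.
Qed.

(** If A -> B is closed under extensions, A covers the sets of the hull one
generation step after the other. *)
Lemma hull_llp X Y (i : hom X (hull X Y)) : st_hom X Y -> llp (rlp generated) i.
Proof.
move=> XY A B p /rlp_generatedP pR; apply: thin_lifts; first exact: st_thin.
move=> XA ZB; constructor; apply/hom_coveredP => S /covered_hull; elim=> {}S.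
- exact: covered_hom.
- by move=> T ST _; exact: covered_sub.
- move=> T ZS AS YT ST RST; apply: (pR S T) => //.
  by apply: covered_hom ZB _; apply/covered_hull/(hull_ext ZS).
Qed.

Lemma hull_ext_closed X Y : ext_closed (hull X Y) Y.
Proof.
move=> S T /covered_hull ZS YT ST RST; exact/covered_hull/(hull_ext ZS).
Qed.

Lemma hull_rlp X Y (p : hom (hull X Y) Y) : rlp generated p.
Proof. exact/rlp_generatedP/hull_ext_closed. Qed.

(** The retract argument: lifting X -> Y against hull R X Y -> Y identifies Y with
the hull. *)
Lemma llp_rlp_hull X Y (i : hom X Y) : llp (rlp generated) i <-> st_hom Y (hull X Y).
Proof.
split=> [iP|YZ A B p pR].
  have [] // := lifts_diagonal st_thin (iP _ _ _ (@hull_rlp X Y (hull_hom i))) (@hom_hull X Y) (@st_id U Y).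
apply: thin_lifts; first exact: st_thin.
move=> XA YB; have [ZA] := lifts_diagonal st_thin
  (@hull_llp X Y (@hom_hull X Y) i A B p pR) XA (st_comp YB (hull_hom i)).
by constructor; exact: st_comp ZA YZ.
Qed.

End Generated.

End Universe.

Arguments hom_hull {U} R X Y _ _ : rename.
Arguments hull_rlp {U} R {X Y} p _ _ _ _ _ _ _ : rename.
Arguments hull_llp {U} R {X Y} i _ _ _ _ _ _ _ _ : rename.

(** * The labels, in terms of covered sets *)

Section Labels.
Variable U : set_universe.
Implicit Types (S T : U) (X Y Z : StNaamen U).

(** The relations for which generated gives the classes (wc)_0 and (c)_0. *)
Definition finite_ext S T : Prop := finite_set (elts T `\` elts S).
Definition card_ext S T : Prop := card_le_add_aleph0 T S.

Lemma card_ext_cofinite S S0 T T0 : finite_ext S0 S -> elts T0 `<=` elts T ->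
  card_ext S T -> card_ext S0 T0.
Proof.
move=> fin T0T /card_le_add_aleph0P ST; apply/card_le_add_aleph0P.
have T0T' : elts T0 #<= elts T by exact: subset_card_le.
case: ST => [Tc|ST]; first by left; exact: sub_countable Tc.
have [Sfin|Sinf] := pselect (finite_set (elts S)); [left|right].
  by apply/finite_set_countable/(card_le_finite T0T')/(card_le_finite ST).
apply: card_le_trans T0T' (card_le_trans ST _).
apply: card_le_trans (card_le_cofinite Sinf fin) _.
by apply: subset_card_le => x [].
Qed.

Lemma card_ext_restrict S T S0 T0 : elts S `<=` elts T -> elts T0 `<=` elts T ->
  finite_ext T0 T -> elts S0 = elts S `&` elts T0 -> card_ext S T -> card_ext S0 T0.
Proof.
move=> ST T0T fin eS0; apply: card_ext_cofinite => //.
apply: sub_finite_set fin => x [Sx]; rewrite eS0 => NS0x.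
by split; [exact: ST|move=> T0x; exact: NS0x].
Qed.

Lemma finite_ext_card S T : elts S `<=` elts T -> finite_ext S T -> card_ext S T.
Proof.
move=> ST fin; apply/card_le_add_aleph0P.
have [Tfin|Tinf] := pselect (finite_set (elts T)); [left|right].
  exact: finite_set_countable.
by rewrite -(setIidr ST); exact: card_le_cofinite.
Qed.

Definition almost_covered X T : Prop :=
  exists S, [/\ elts S `<=` elts T, covered X S & finite_ext S T].

Lemma covered_almost X T : covered X T -> almost_covered X T.
Proof. by exists T; split=> //; rewrite /finite_ext setDv. Qed.

Lemma almost_covered_hom X Y T : st_hom X Y -> almost_covered X T -> almost_covered Y T.
Proof. by move=> XY [S [ST /(covered_hom XY) YS fin]]; exists S. Qed.

Lemma almost_covered_sub X S T : elts S `<=` elts T ->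
  almost_covered X T -> almost_covered X S.
Proof.
move=> ST [T0 [T0T XT0 fin]]; have [S0 eS0] := separation S (elts T0).
exists S0; split; first by rewrite eS0 => x [].
- by apply: covered_sub XT0; rewrite eS0 => x [].
- apply: sub_finite_set fin => x [Sx]; rewrite eS0 => NS0x.
  by split; [exact: ST|move=> T0x; exact: NS0x].
Qed.

Lemma almost_covered_ext X S T : elts S `<=` elts T -> finite_ext S T ->
  almost_covered X S -> almost_covered X T.
Proof.
move=> ST fin [S0 [S0S XS0 fin0]]; exists S0; split=> //.
  exact: subset_trans ST.
apply: (@sub_finite_set _ _ ((elts T `\` elts S) `|` (elts S `\` elts S0))).
  by move=> x [Tx NS0x]; have [Sx|NSx] := pselect (elts S x); [right|left].
by rewrite finite_setU.
Qed.

(** Unlike the cardinality hull, this one is reached in a single step, because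
almost_covered is already closed under subsets and finite extensions. *)
Lemma covered_hull_finite X Y T : st_hom X Y ->
  covered (hull finite_ext X Y) T <-> covered Y T /\ almost_covered X T.
Proof.
move=> XY; split=> [ZT|[YT [S [ST XS fin]]]].
  split; first exact: covered_hom (hull_hom XY) ZT.
  move/covered_hull: ZT; elim=> [{}T /covered_almost//|S {}T ST _|S {}T _ XS _ ST fin].
    exact: almost_covered_sub.
  exact: almost_covered_ext XS.
by apply/covered_hull/(@hull_ext _ _ _ _ S T) => //; exact: hull_base.
Qed.

Lemma st_fP X Y (p : hom X Y) : st_f p <-> ext_closed finite_ext X Y.
Proof. exact: rlp_generatedP. Qed.

Lemma st_wfP X Y (p : hom X Y) : st_wf p <-> ext_closed card_ext X Y.
Proof. exact: rlp_generatedP. Qed.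

Lemma st_wf_f X Y (p : hom X Y) : st_wf p -> st_f p.
Proof.
move=> /st_wfP pR; apply/st_fP => S T XS YT ST fin.
by apply: (pR S T) => //; exact: finite_ext_card.
Qed.

Lemma st_wc_c X Y (i : hom X Y) : st_wc i -> st_c i.
Proof. by move=> iP A B p /st_wf_f; exact: iP. Qed.

Lemma st_wcP X Y (i : hom X Y) :
  st_wc i <-> forall T, covered Y T -> almost_covered X T.
Proof.
split=> [/llp_rlp_hull YZ T YT|H].
  by have [] := (covered_hull_finite T i).1 (covered_hom YZ YT).
by apply/llp_rlp_hull/hom_coveredP => T YT; apply/(covered_hull_finite T i); split; last exact: H.
Qed.

(** If f factors as (wc) followed by (wf), the middle object covers the same sets
as the hull for finite extensions; so f is a weak equivalence iff this hull is closed in Y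
under the extensions of (c)_0.  A set almost covered by X has the same
cardinality up to aleph_0 as its covered cofinite part, so it suffices to
extend sets covered by X. *)
Lemma st_wP X Y (f : hom X Y) : st_w f <-> forall S T,
  covered X S -> covered Y T -> elts S `<=` elts T -> card_ext S T -> almost_covered X T.
Proof.
split=> [[Z [i [p [/st_wcP iP /st_wfP pP]]]] S T XS YT ST RST|H].
  by apply: iP; apply: (pP S T) => //; exact: covered_hom XS.
exists (hull finite_ext X Y), (hom_hull _ _ _), (hull_hom f); split.
  by apply/st_wcP => T /(covered_hull_finite T f)[].
apply/st_wfP => S T /(covered_hull_finite S f)[YS [S0 [S0S XS0 fin]]] YT ST RST.
apply/(covered_hull_finite T f); split=> //; apply: (H S0) => //.
  exact: subset_trans ST.
exact: card_ext_cofinite RST.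
Qed.

Lemma iso_llp (K : arrow_class (StNaamen_cat U)) X Y (i : hom X Y) :
  st_hom Y X -> llp K i.
Proof.
move=> YX A B p _; apply: thin_lifts; first exact: st_thin.
by move=> XA _; constructor; exact: st_comp XA YX.
Qed.

Lemma iso_rlp (K : arrow_class (StNaamen_cat U)) X Y (p : hom X Y) :
  st_hom Y X -> rlp K p.
Proof.
move=> YX A B i _; apply: thin_lifts; first exact: st_thin.
by move=> _ BY; constructor; exact: st_comp YX BY.
Qed.

Lemma st_wc_w X Y (i : hom X Y) : st_wc i -> st_w i.
Proof.
by move=> iP; exists Y, i, (@st_id U Y); split=> //; apply: iso_rlp; exact: st_id.
Qed.

Lemma st_wf_w X Y (p : hom X Y) : st_wf p -> st_w p.
Proof.
by move=> pP; exists X, (@st_id U X), p; split=> //; apply: iso_llp; exact: st_id.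
Qed.

Lemma st_w_c_wc X Y (i : hom X Y) : st_w i -> st_c i -> st_wc i.
Proof.
move=> [Z [j [p [/st_wcP jP pP]]]] iP.
have [YZ] := lifts_diagonal (@st_thin U) (iP _ _ _ pP) j (@st_id U Y).
by apply/st_wcP => T /(covered_hom YZ); exact: jP.
Qed.

Lemma st_w_f_wf X Y (p : hom X Y) : st_w p -> st_f p -> st_wf p.
Proof.
move=> [Z [i [q [iP /st_wfP qP]]]] pP.
have [ZX] := lifts_diagonal (@st_thin U) (iP _ _ _ pP) (@st_id U X) q.
apply/st_wfP => S T XS YT ST RST; apply: covered_hom ZX _.
by apply: (qP S T) => //; exact: covered_hom i XS.
Qed.

(** For infinite S', the set S' u S'' is no larger than S'; Y covers it by
uniformity, so the extension property applied to S' makes X cover it. *)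
Lemma uniform_ext_closed_card X Y : st_hom X Y -> ext_closed card_ext X Y ->
  uniform Y -> uniform X.
Proof.
move=> XY XYR Yu S XS; split=> // S' S'S XS' S'' S''S S''S'.
have [S'fin|S'inf] := pselect (finite_set (elts S')).
  by apply: XS => //; exact/finite_set_countable/(card_le_finite S''S').
have [T eT] := separation S (elts S' `|` elts S'').
have {}eT : elts T = elts S' `|` elts S''.
  by rewrite eT; apply/seteqP; split=> [x []|x [/[dup]/S'S|/[dup]/S''S]]//; split=> //; [left|right].
have TS' : elts T #<= elts S' by rewrite eT; apply: card_le_setU.
have YS : countably_covers Y S by move=> D DS Dc; apply: covered_hom XY _; exact: XS.
suff : covered X T by apply: covered_sub; rewrite eT => x; right.
apply: (XYR S' T) => //.
- apply: (Yu S YS).2 (covered_hom XY XS') _ _ TS' => //.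
  by rewrite eT => x [/S'S|/S''S].
- by rewrite eT => x; left.
- by apply/card_le_add_aleph0P; right.
Qed.

Lemma finite_sub_bigcup_nondecreasing (W : Type) (D : nat -> set W) (F : set W) :
  (forall m n, (m <= n)%N -> D m `<=` D n) -> finite_set F ->
  F `<=` \bigcup_n D n -> exists n, F `<=` D n.
Proof.
move=> Dmono /finite_setP[k]; elim: k F => [|k IHk] F.
  by rewrite II0 card_eq0 => /eqP-> _; exists 0.
move=> /eq_cardSP[x Fx /IHk IH] FD.
have [|n FDn] := IH; first by move=> y [/FD].
have [m _ Dmx] := FD x Fx; exists (maxn m n) => y Fy.
have [->|yx] := pselect (y = x); first by apply: (Dmono m) => //; exact: leq_maxl.
by apply: (Dmono n); [exact: leq_maxr|apply: FDn].
Qed.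

(** Otherwise every finite F leaves in S \ F a countable set g F not covered by X.
Close the empty set under F |-> g F for finite subsets F: the result is
countable, so X covers it outside some finite subset F of it; but g F lies in
that part. *)
Lemma cofinite_countably_covers X S :
  (forall D, elts D `<=` elts S -> countable (elts D) -> almost_covered X D) ->
  exists S0, [/\ elts S0 `<=` elts S, finite_ext S0 S & countably_covers X S0].
Proof.
move=> almost; apply: contrapT => none.
have /choice[g gP] : forall F : set U, exists D, finite_set F ->
    [/\ elts D `<=` elts S `\` F, countable (elts D) & ~ covered X D].
  move=> F; apply: contrapT => noD; apply: none.
  have [S0 eS0] := separation S (~` F); exists S0; split.
  - by rewrite eS0 => x [].
  - rewrite /finite_ext eS0 setDE setCI setCK setIUr setICr set0U.
    by apply: finite_setIr; apply: contrapT => Finf; apply: noD; exists S => /Finf.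
  - move=> D DS0 Dc; apply: contrapT => ND; apply: noD; exists D; split=> //.
    by rewrite setDE -eS0.
pose subs (E : set U) := [set F : set U | F `<=` E /\ finite_set F].
pose step (E : set U) := E `|` \bigcup_(F in subs E) elts (g F).
pose E n := iter n step set0.
have Emono m n : (m <= n)%N -> E m `<=` E n.
  move=> /subnK <-; elim: (n - m)%N => // k IHk x /IHk Ex.
  by rewrite addSn; left.
have Ec n : countable (E n).
  elim: n => [|n IHn]; first exact: countable0.
  have -> : E n.+1 = \bigcup_(b in [set: bool]) if b then E n else
      \bigcup_(F in subs (E n)) elts (g F).
    apply/seteqP; split=> [x [Ex|Gx]|x [[] _ Ex]]; by [exists true|exists false|left|right].
  apply: bigcup_countable => // -[] _ //; apply: bigcup_countable.
    exact: countable_finite_subset.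
  by move=> F [_ /gP[]].
have ES n : E n `<=` elts S.
  by elim: n => // n IHn x [/IHn//|[F [_ /gP[gS _ _]] /gS[]]].
have [D eD] := separation S (\bigcup_n E n).
have DE : elts D = \bigcup_n E n.
  by rewrite eD; apply: setIidr; apply: bigcup_sub => n _.
have [||A [AD XA fin]] := almost D.
- by rewrite eD => x [].
- by rewrite DE; apply: bigcup_countable.
have [|n FEn] := finite_sub_bigcup_nondecreasing Emono fin.
  by rewrite -DE => x [].
have [gS _ ] := gP _ fin; apply; apply: covered_sub XA => x gx.
apply: contrapT => NAx; have [_] := gS x gx; apply; split=> //.
rewrite DE; exists n.+1 => //; right; exists (elts D `\` elts A) => //.
Qed.

(** Let S be countably covered by the hull.  X uniformly covers a cofinite part S0
of S, and finitely many points do not change the cardinality of an infinite S';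
so X covers the part of S'' in S0. *)
Lemma uniform_hull_finite X Y : st_hom X Y -> uniform X -> uniform Y ->
  uniform (hull finite_ext X Y).
Proof.
move=> XY Xu Yu S ZS; split=> // S' S'S ZS' S'' S''S S''S'.
have Z_Y : st_hom (hull finite_ext X Y) Y := hull_hom XY.
have YS : countably_covers Y S by move=> D DS Dc; apply: covered_hom Z_Y _; exact: ZS.
have [S'fin|S'inf] := pselect (finite_set (elts S')).
  by apply: ZS => //; exact/finite_set_countable/(card_le_finite S''S').
have [|S0 [S0S fin XS0]] := @cofinite_countably_covers X S.
  by move=> D DS Dc; have [] := (covered_hull_finite D XY).1 (ZS D DS Dc).
apply/(covered_hull_finite S'' XY); split.
  exact: ((Yu S YS).2 S' S'S (covered_hom Z_Y ZS')).
have [_ [A [AS' XA Afin]]] := (covered_hull_finite S' XY).1 ZS'.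
have [A0 eA0] := separation A (elts S0).
have [B eB] := separation S'' (elts S0).
exists B; split; first by rewrite eB => x [].
  apply: ((Xu S0 XS0).2 A0).
  - by rewrite eA0 => x [].
  - by apply: covered_sub XA; rewrite eA0 => x [].
  - by rewrite eB => x [].
  - have S'A0 : elts S' #<= elts A0.
      have -> : elts A0 = elts S' `&` elts A0.
        by rewrite setIidr// eA0 => x [/AS'].
      apply: card_le_cofinite => //.
      apply: (@sub_finite_set _ _ ((elts S' `\` elts A) `|` (elts S `\` elts S0))).
        move=> x [S'x]; rewrite eA0 => NA0x.
        have [Ax|NAx] := pselect (elts A x); [right|by left].
        by split; [exact: S'S|move=> S0x; exact: NA0x].
      by rewrite finite_setU.
    apply: card_le_trans (card_le_trans S''S' S'A0).
    by apply: subset_card_le; rewrite eB => x [].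
apply: sub_finite_set fin => x [S''x]; rewrite eB => NBx.
by split; [exact: S''S|move=> S0x; exact: NBx].
Qed.

Lemma uniform_hull_card X Y : st_hom X Y -> uniform Y -> uniform (hull card_ext X Y).
Proof.
by move=> XY; apply: uniform_ext_closed_card (hull_hom XY) (@hull_ext_closed _ _ _ _).
Qed.

Lemma st_w_comp X Y Z (f : hom X Y) (g : hom Y Z) :
  st_w f -> st_w g -> st_w (g \o f)%cat.
Proof.
move=> /st_wP fw /st_wP gw; apply/st_wP => S T XS ZT ST RST.
have [T0 [T0T YT0 fin]] := gw S T (covered_hom f XS) ZT ST RST.
apply: (almost_covered_ext T0T fin).
have [S0 eS0] := separation S (elts T0).
apply: (fw S0) => //.
- by apply: covered_sub XS; rewrite eS0 => x [].
- by rewrite eS0 => x [].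
- exact: card_ext_restrict eS0 RST.
Qed.

Lemma st_w_cancel_right X Y Z (f : hom X Y) (g : hom Y Z) :
  st_w (g \o f)%cat -> st_w f.
Proof.
move=> /st_wP hw; apply/st_wP => S T XS YT ST RST.
exact: hw XS (covered_hom g YT) ST RST.
Qed.

(** If T is countable, compare it with the empty set, which X covers: by the
criterion for X -> Z, X covers T up to finitely many points.  The same holds
for every countable subset of an uncountable T, so some cofinite part T0 of T
has all its countable subsets covered by X, hence by Y.  As S and T have the same
cardinality, so do their parts in T0, and uniformity of Y passes from one to
the other. *)
Lemma st_w_cancel_left X Y Z (f : hom X Y) (g : hom Y Z) :
  uniform Y -> st_w (g \o f)%cat -> st_w g.
Proof.
move=> Yu /st_wP hw; apply/st_wP => S T YS ZT ST RST.
have [E eE] := separation S set0; rewrite setI0 in eE.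
have almost D : elts D `<=` elts T -> countable (elts D) -> almost_covered X D.
  move=> DT Dc; apply: (hw E) => //.
  - exact: covered_empty.
  - exact: covered_sub ZT.
  - by rewrite eE.
  - by apply/card_le_add_aleph0P; left.
have [Tc|Tinf] := pselect (countable (elts T)).
  by apply: almost_covered_hom f _; exact: almost.
have [T0 [T0T fin XT0]] := cofinite_countably_covers almost.
exists T0; split=> //.
have [S0 eS0] := separation S (elts T0).
have RST0 : card_ext S0 T0 by exact: card_ext_restrict eS0 RST.
have YT0 : countably_covers Y T0.
  by move=> D DT0 Dc; apply: covered_hom f _; exact: XT0.
have [T0c|T0S0] := (card_le_add_aleph0P _ _).1 RST0; first exact: YT0.
apply: ((Yu T0 YT0).2 S0) => //.
  by rewrite eS0 => x [].
by apply: covered_sub YS; rewrite eS0 => x [].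
Qed.

(** The object W of countable sets covered by X maps to X by a (wf) arrow, since
the extensions of (c)_0 keep countable sets countable; lifting yields X -> W. *)
Lemma cofibrant_countable X (f : hom st_empty X) T :
  st_c f -> covered X T -> countable (elts T).
Proof.
move=> fc XT; pose P := [set S | covered X S /\ countable (elts S)].
have dP : downward_closed P.
  move=> A B AB [XB Bc]; split; first exact: covered_sub XB.
  by apply: sub_countable Bc; exact: subset_card_le.
have [E eE] := st_empty_subproof U.
have P0 : P !=set0 by exists E; split; [exact: covered_empty|rewrite eE; exact: countable0].
pose W : StNaamen U := exist _ P P0.
have WP S : covered W S <-> P S by exact: covered_downward_closed.
have p : st_hom W X by apply/hom_coveredP => S /WP[].
have pw : st_wf (p : hom W X).
  apply/st_wfP => A B /WP[_ Ac] XB _ /card_le_add_aleph0P RAB.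
  by apply/WP; split=> //; case: RAB => // /sub_countable; apply.
have eW : st_hom st_empty W.
  by move=> A /= A0; exists E; [split; [exact: covered_empty|rewrite eE; exact: countable0]|rewrite A0].
have [XW] := lifts_diagonal (@st_thin U) (fc _ _ _ pw) eW (@st_id U X).
by have /WP[] := covered_hom XW XT.
Qed.

Lemma cofibrant_uniform X (f : hom st_empty X) : st_c f -> uniform X.
Proof.
move=> fc S XS; split=> // S' _ XS' S'' S''S S''S'; apply: XS => //.
exact: sub_countable S''S' (cofibrant_countable fc XS').
Qed.

End Labels.

(** * Uniform objects *)

Section Qt.
Variable U : set_universe.
Implicit Types (S T : U) (X Y Z A B : QtNaamen U).

Lemma qt_thin X Y (f g : hom X Y) : f = g.
Proof. exact: (@st_thin U (sval X) (sval Y)). Qed.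

Definition qt_singleton S : QtNaamen U := exist _ (singleton S) (@uniform_singleton U S).

Section Intersection.
Variable P : set (StNaamen U).

Definition meet_mem : set U := [set S | forall W, P W -> covered W S].

Lemma meet_nonempty : meet_mem !=set0.
Proof. by have [E eE] := st_empty_subproof U; exists E => X _; exact: covered_empty. Qed.

Definition meet : StNaamen U := exist _ meet_mem meet_nonempty.

Lemma covered_meet S : covered meet S <-> forall W, P W -> covered W S.
Proof. by apply: covered_downward_closed => A B AB mB X /mB; exact: covered_sub. Qed.

Lemma uniform_meet : P `<=` @uniform U -> uniform meet.
Proof.
move=> Pu S mS; split=> // S' S'S /covered_meet mS' S'' S''S S''S'.
apply/covered_meet => X PX.
apply: ((Pu X PX S _).2 S') => //; last exact: mS'.
by move=> D DS Dc; apply: ((covered_meet D).1 (mS D DS Dc)).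
Qed.

End Intersection.

Lemma qt_finite_limits : has_finite_limits (QtNaamen U).
Proof.
move=> J D _; pose P : set (StNaamen U) := [set X | exists j : J, X = sval (D j)].
have Pu : P `<=` @uniform U by move=> _ [j ->]; exact: svalP.
exists (exist _ (meet P) (uniform_meet Pu)).
have pr j : st_hom (meet P) (sval (D j)).
  by apply/hom_coveredP => S /covered_meet; apply; exists j.
exists pr; split=> [i j a|M q _]; first exact: qt_thin.
have h : st_hom (sval M) (meet P).
  by apply/hom_coveredP => S MS; apply/covered_meet => _ [j ->]; exact: covered_hom (q j) MS.
by exists h; split=> [j|h' _]; exact: qt_thin.
Qed.

(** A colimit is the intersection of all uniform upper bounds; the union of the
diagram need not be uniform. *)
Lemma qt_finite_colimits : has_finite_colimits (QtNaamen U).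
Proof.
move=> J D _; pose P : set (StNaamen U) :=
  [set X | uniform X /\ forall j, st_hom (sval (D j)) X].
have Pu : P `<=` @uniform U by move=> X [].
exists (exist _ (meet P) (uniform_meet Pu)).
have inj j : st_hom (sval (D j)) (meet P).
  by apply/hom_coveredP => S DS; apply/covered_meet => X [_ /(_ j)/covered_hom]; apply.
exists inj; split=> [i j a|M q _]; first exact: qt_thin.
have h : st_hom (meet P) (sval M).
  by apply/hom_coveredP => S /covered_meet; apply; split; [exact: svalP|exact: q].
by exists h; split=> [j|h' _]; exact: qt_thin.
Qed.

Section Generated.
Variable R : U -> U -> Prop.

Definition preserves_uniform : Prop := forall X Y,
  st_hom (sval X) (sval Y) -> uniform (hull R (sval X) (sval Y)).

(** The universal property is needed only for the test objects {T}, which are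
uniform. *)
Lemma qt_pullback_rlp X' X Y' Y (f' : hom X' Y') (g' : hom X' X)
    (f : hom X Y) (g : hom Y' Y) :
  is_pullback f' g' f g -> rlp (generated R) f -> rlp (generated R) f'.
Proof.
move=> [_ pb] /rlp_generatedP fR; apply/rlp_generatedP => S T XS YT ST RST.
have XT : covered (sval X) T.
  by apply: (fR S T) => //; [exact: covered_hom g' XS|exact: covered_hom g YT].
have [h _] := pb (qt_singleton T) (singleton_hom XT) (singleton_hom YT) (qt_thin _ _).
by apply: covered_hom h _; apply/covered_singleton.
Qed.

Hypothesis hullu : preserves_uniform.

Let qt_hull X Y (XY : st_hom (sval X) (sval Y)) : QtNaamen U := exist _ _ (hullu XY).

(** The hull Z of X' in Y' receives X', and receives Y because X -> Y lifts against
Z -> Y'.  As Z is uniform, it receives the pushout Y' too. *)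
Lemma qt_pushout_llp X X' Y Y' (f : hom X Y) (g : hom X X')
    (f' : hom X' Y') (g' : hom Y Y') :
  is_pushout f g f' g' -> llp (rlp (generated R)) f -> llp (rlp (generated R)) f'.
Proof.
move=> [_ po] fc; have p := @hull_hom _ R _ _ f'.
have [YZ] := lifts_diagonal (@st_thin U) (fc _ _ p (hull_rlp R p))
  (st_comp (hom_hull R _ (sval Y')) g) g'.
have [h _] := po (qt_hull f') YZ (hom_hull R _ (sval Y')) (qt_thin _ _).
exact/llp_rlp_hull.
Qed.

Lemma qt_factorization X Y (f : hom X Y) : exists Z (i : hom X Z) (p : hom Z Y),
  llp (rlp (generated R)) i /\ rlp (generated R) p.
Proof.
exists (qt_hull f), (hom_hull R _ (sval Y)), (hull_hom f).
by split; [exact: hull_llp|exact: hull_rlp].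
Qed.

(** The hull of X in Y is uniform, so lifting against uniform objects already
identifies Y with it. *)
Lemma llp_of_qt_llp X Y (i : hom X Y) :
  (forall A B (p : hom A B), rlp (generated R) p -> lifts i p) -> llp (rlp (generated R)) i.
Proof.
move=> H; have [YZ] := lifts_diagonal qt_thin
  (H (qt_hull i) Y (hull_hom i) (hull_rlp R (X := sval X) (Y := sval Y) _)) (hom_hull R _ (sval Y)) (idc Y).
exact/llp_rlp_hull.
Qed.

Lemma rlp_of_qt_rlp X Y (p : hom X Y) :
  (forall A B (i : hom A B), llp (rlp (generated R)) i -> lifts i p) -> rlp (generated R) p.
Proof.
move=> H; have [ZX] := lifts_diagonal qt_thin
  (H X (qt_hull p) (hom_hull R _ (sval Y)) (hull_llp R (X := sval X) (Y := sval Y) _ p)) (idc X) (hull_hom p).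
apply/rlp_generatedP => S T XS YT ST RST; apply: covered_hom ZX _.
by apply: (@hull_ext_closed U R (sval X) (sval Y) S T) => //; exact: covered_hom (hom_hull R _ (sval Y)) XS.
Qed.

End Generated.

Lemma finite_ext_preserves_uniform : preserves_uniform (@finite_ext U).
Proof. by move=> X Y XY; apply: uniform_hull_finite => //; exact: svalP. Qed.

Lemma card_ext_preserves_uniform : preserves_uniform (@card_ext U).
Proof. by move=> X Y XY; apply: uniform_hull_card => //; exact: svalP. Qed.

Local Notation finu := finite_ext_preserves_uniform.
Local Notation cardu := card_ext_preserves_uniform.

Lemma qt_triv_cofE X Y (i : hom X Y) : triv_cof i <-> @st_wc U (sval X) (sval Y) i.
Proof.
split=> [[iw ic]|iP]; first exact: st_w_c_wc.
by split; [exact: st_wc_w|exact: st_wc_c].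
Qed.

Lemma qt_triv_fibE X Y (p : hom X Y) : triv_fib p <-> @st_wf U (sval X) (sval Y) p.
Proof.
split=> [[pw pf]|pP]; first exact: st_w_f_wf.
by split; [exact: st_wf_w|exact: st_wf_f].
Qed.

Lemma qt_M1 : axiom_M1 (QtNaamen U).
Proof.
move=> X Y A B i p; split=> [/qt_triv_cofE iP pP|iP /qt_triv_fibE pP]; exact: iP pP.
Qed.

Lemma qt_M2 : axiom_M2 (QtNaamen U).
Proof.
move=> X Y f; split.
  have [Z [i [p [ic pf]]]] := qt_factorization cardu f.
  by exists Z, i, p; split; [exact: qt_thin| |apply/qt_triv_fibE].
have [Z [i [p [ic pf]]]] := qt_factorization finu f.
by exists Z, i, p; split; [exact: qt_thin|apply/qt_triv_cofE|].
Qed.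

Lemma qt_M3 : axiom_M3 (QtNaamen U).
Proof.
split.
- move=> X Y Z f g /st_fP fP /st_fP gP; apply/st_fP => S T XS ZT ST RST.
  apply: (fP S T) => //; apply: (gP S T) => //; exact: covered_hom f XS.
- move=> X Y Z f g fP gP A B p pP; apply: thin_lifts; first exact: st_thin.
  move=> XA ZB; have [YA] := lifts_diagonal (@st_thin U) (fP _ _ _ pP) XA (st_comp ZB g).
  by have [ZA] := lifts_diagonal (@st_thin U) (gP _ _ _ pP) YA ZB.
- move=> X Y f [g _]; split; [|exact: iso_llp g|exact: iso_rlp g].
  by apply: st_wf_w; exact: iso_rlp g.
- by move=> X' X Y' Y f' g' f g; exact: qt_pullback_rlp.
- by move=> X X' Y Y' f g f' g'; exact: (qt_pushout_llp cardu).
Qed.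

Lemma qt_M4 : axiom_M4 (QtNaamen U).
Proof.
split=> [X' X Y' Y f' g' f g pb /qt_triv_fibE fP|X X' Y Y' f g f' g' po /qt_triv_cofE fP].
  by apply: st_wf_w; exact: qt_pullback_rlp pb fP.
by apply: st_wc_w; exact: (qt_pushout_llp finu po fP).
Qed.

Lemma qt_M5 : axiom_M5 (QtNaamen U).
Proof.
move=> X Y Z f g; split=> [fw gw|fw gfw|gw gfw].
- exact: st_w_comp fw gw.
- exact: (@st_w_cancel_left U _ _ _ f g (svalP Y) gfw).
- exact: (@st_w_cancel_right U _ _ _ f g gfw).
Qed.

Lemma qt_M6 : axiom_M6 (QtNaamen U).
Proof.
move=> X Y f; split.
- split=> [fP A B i /qt_triv_cofE iP|H]; first exact: iP fP.
  by apply: (rlp_of_qt_rlp finu) => A B i iP; apply: H; apply/qt_triv_cofE.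
- split=> [fP A B p /qt_triv_fibE pP|H]; first exact: fP pP.
  by apply: (llp_of_qt_llp cardu) => A B p pP; apply: H; apply/qt_triv_fibE.
- split=> [[Z [i [p [iP pP]]]]|[Z [v [u [_ vP uP]]]]].
    have Zu : uniform Z.
      by apply: (uniform_ext_closed_card p) (svalP Y); apply/(st_wfP p).
    exists (exist _ Z Zu), i, p; split; first exact: qt_thin.
      by move=> A B q qP; exact: iP qP.
    by move=> A B q qP; exact: qP pP.
  exists (sval Z), v, u; split.
    exact: (llp_of_qt_llp finu).
  exact: (rlp_of_qt_rlp cardu).
Qed.

End Qt.

Theorem theorem48 (U : set_universe) :
  closed_model_category (QtNaamen U) /\
  (forall (X : StNaamen U) (f : hom st_empty X), cof f -> uniform X).
Proof.
split; last by move=> X f; exact: cofibrant_uniform.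
split; split; [split| | | | | |].
- exact: qt_finite_limits.
- exact: qt_finite_colimits.
- exact: qt_M1.
- exact: qt_M2.
- exact: qt_M3.
- exact: qt_M4.
- exact: qt_M5.
- exact: qt_M6.
Qed.
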